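(* Let $\mathcal{E}=(\succ,P,q)$ be a school choice market that satisfies the generalized mutually best pairs (GMBP) condition. Then there is a unique envyfree allocation $\mu$ in $\mathcal{E}$, and $\mu$ is (Pareto) efficient. Moreover, $\mu$ is produced by the student-proposing deferred acceptance (DA) mechanism, by the school-proposing DA mechanism and by the immediate acceptance (IA) mechanism, in the following sense: the outcome of student-proposing DA under truthful reports is $\mu$; the set of (pure) Nash equilibrium outcomes of the preference revelation game induced by school-proposing DA is $\{\mu\}$; and the set of (pure) Nash equilibrium outcomes of the preference revelation game induced by IA is $\{\mu\}$.
   Context: **Market.** $I$ is a finite set of $n$ students, $S$ a finite set of $m$ schools, and $s_{m+1}\notin S$ is the outside option, treated as an additional school with capacity $q_{s_{m+1}}=n$. Write $\bar S=S\cup\{s_{m+1}\}$. A market $\mathcal{E}=(\succ,P,q)$ consists of: for each student $i$ a strict linear order $\succ_i$ on $\bar S$ (with $\succeq_i$ its weak version); capacities $q_s\ge 1$ (integers) for $s\in S$; and for each $s\in S$ a strict linear order $P_s$ (priority list) on the set of students who find $s$ acceptable, i.e. with $s\succ_i s_{m+1}$ ($iP_sj$: $i$ has higher priority than $j$). The outside option has an arbitrary strict priority order over all of $I$. **Allocations.** An allocation is a map $\mu:I\to\bar S$; it is feasible if $|\mu^{-1}(s)|\le q_s$ for all $s$. A feasible $\mu$ is efficient if there is no feasible $\mu'$ with $\mu'(i)\succeq_i\mu(i)$ for all $i$ and $\mu'(i)\succ_i\mu(i)$ for some $i$. A pair $(i,s)$, $s\in\bar S$, blocks $\mu$ if $s\succ_i\mu(i)$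 and either $|\mu^{-1}(s)|<q_s$ or $iP_sj$ for some $j\in\mu^{-1}(s)$. A feasible allocation is envyfree (stable) if no pair blocks it. **Simplified market.** School $s$ is irrelevant for student $i$ if there is $s'\ne s$ in $\bar S$ with $s'\succ_i s$, $i$ on the priority list of $s'$, and $|\{j: jP_{s'}i\}|<q_{s'}$. Iterative elimination of irrelevant schools: at each step, find for every student all irrelevant schools in the current market; delete them from the student's preference list and delete the student from the priority lists of these schools; repeat in the new market (the preference lists now being strict orders on the remaining schools, priorities being strict orders on the remaining students) until no student has an irrelevant school. The result is the simplified market $\mathcal{E}^*=(\succ^*,P^*,q)$; $\succ^*_i$ is a truncation of $\succ_i$ and $P^*_s$ a restriction of $P_s$. **SMBP.** A market (original or simplified) satisfies the sequential mutually best pairs (SMBP) condition if there are an ordering $i_1,\dots,i_n$ of the students and an associated list $s_{(1)},\dots,s_{(n)}$ of elements of $\bar S$, in which no school appears more often than its capacity, such that for every $k=1,\dots,n$, with remaining capacities $q_s^k=q_s-\sum_{l=1}^{k-1}1_{\{s_{(l)}=s\}}$ and $S^k=\{s\in\bar S:q^k_s>0\}$: (i) $s_{(k)}\in S^k$ is on $i_k$'s preference list and is $i_k$'s most preferred school among the schools of $S^k$ on $i_k$'s preference list; (ii) $i_k$ is on the priority list of $s_{(k)}$ and is among the top $q^k_{s_{(k)}}$ students of that list among the students $i_k,i_{k+1},\dots,i_n$. **GMBP.** $\mathcal{E}$ satisfies the generalized mutually best pairs condition if its simplified market $\mathcal{E}^*$ satisfies SMBP. **Mechanisms and games.** Each mechanism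 takes reported preferences (strict linear orders on $\bar S$), priorities and capacities as input. For reports different from the true ones, fix for each $s\in S$ a strict linear order on all of $I$ extending $P_s$ (any choice), and let the priority list of $s$ at a reported profile be the restriction of this order to students reporting $s$ acceptable. In the preference revelation game of a mechanism, priorities and capacities are fixed, the players are the students, strategies are reported preferences, and outcomes are evaluated with the true preferences $\succ$. The outside option is treated as a school with capacity $n$ listing all students. *Student-proposing DA*: at each step, every student not currently provisionally accepted proposes to her best school among those that have not rejected her; every school provisionally accepts the (up to) $q_s$ highest-priority students among those who have proposed to it so far and rejects the others; stop when there are no rejections, and make provisional acceptances final. *School-proposing DA*: at each step, every school proposes to the (up to) $q_s$ highest-priority students on its list among those who have not rejected it; every student provisionally accepts the best school among those that have proposed to her and rejects the others; stop when there are no rejections, and make provisional acceptances final. *IA (Boston mechanism)*: at each step, every student not yet accepted proposes to her best school among those with remaining seats that have not rejected her; every school permanently accepts the highest-priority proposers up to its remaining capacity and rejects the others; capacities are reduced by the number of accepted students; stop when every student is accepted. *)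

(* Defs.v *)
From mathcomp Require Import all_boot.
Set Implicit Arguments.
Unset Strict Implicit.
Unset Printing Implicit Defensive.

Definition strict_linear_on (T : finType) (A : {set T}) (r : rel T) : Prop :=
  [/\ forall x y, r x y -> (x \in A) && (y \in A),
      irreflexive r,
      transitive r
    & {in A &, forall x y, x != y -> r x y || r y x}].

(* A preference or priority list: [o x y] means that both [x] and [y] are on  *)
(* the list and that [x] comes strictly before [y].                           *)
Record order_on (T : finType) := OrderOn {
  dom : {set T};
  rel_of :> rel T;
  order_onP : strict_linear_on dom rel_of }.

Definition weakly (T : finType) (o : order_on T) : rel T :=
  fun x y => (x == y) || o x y.

Lemma restrict_subproof (T : finType) (o : order_on T) (A : {set T}) :
  strict_linear_on (dom o :&: A) [rel x y | [&& x \in A, y \in A & o x y]].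
Proof.
case: o => D r [rD rirr rtr rtot]; split=> /=.
- move=> x y /and3P[xA yA rxy]; have /andP[xD yD] := rD _ _ rxy.
  by rewrite !inE xA yA xD yD.
- by move=> x; rewrite /= rirr !andbF.
- move=> y x z /= /and3P[xA _ rxy] /and3P[_ zA ryz].
  by rewrite xA zA (rtr _ _ _ rxy ryz).
- by move=> x y /setIP[xD xA] /setIP[yD yA] xy; rewrite xA yA /=; apply: rtot.
Qed.

Definition restrict (T : finType) (o : order_on T) (A : {set T}) : order_on T :=
  OrderOn (restrict_subproof o A).

Definition top (T : finType) (q : nat) (o : order_on T) (A : {set T}) : {set T} :=
  [set x in A :&: dom o | #|[set y in A :&: dom o | o y x]| < q].

Definition is_best (T : finType) (o : order_on T) (A : {set T}) (x : T) : bool :=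
  (x \in A :&: dom o) && [forall y in A :&: dom o, weakly o x y].

(* [None : option S] is the outside option. Original, simplified and reported *)
(* markets all have this type; they differ in the domains of the lists.       *)
Record market (I S : finType) := Market {
  pref : I -> order_on (option S);
  prio : option S -> order_on I;
  cap : option S -> nat }.

Definition school_choice_market (I S : finType) (E : market I S) : Prop :=
  [/\ forall i, dom (pref E i) = setT,
      forall s, dom (prio E (Some s)) = [set i | pref E i (Some s) None],
      dom (prio E None) = setT,
      forall s, 0 < cap E (Some s)
    & cap E None = #|I|].

Definition allocation (I S : finType) := {ffun I -> option S}.

Definition assigned (I S : finType) (mu : allocation I S) (s : option S) : {set I} :=
  [set i | mu i == s].

Definition feasible (I S : finType) (E : market I S) (mu : allocation I S) : Prop :=
  forall s, #|assigned mu s| <= cap E s.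

Definition efficient (I S : finType) (E : market I S) (mu : allocation I S) : Prop :=
  feasible E mu /\
  ~ exists nu, [/\ feasible E nu,
                   forall i, weakly (pref E i) (nu i) (mu i)
                 & exists i, pref E i (nu i) (mu i)].

Definition blocks (I S : finType) (E : market I S) (mu : allocation I S)
    (i : I) (s : option S) : bool :=
  pref E i s (mu i) &&
  ((#|assigned mu s| < cap E s) || [exists j in assigned mu s, prio E s i j]).

Definition envyfree (I S : finType) (E : market I S) (mu : allocation I S) : Prop :=
  feasible E mu /\ forall i s, ~~ blocks E mu i s.

Definition irrelevant (I S : finType) (E : market I S) (i : I) (s : option S) : bool :=
  [exists t, [&& t != s, pref E i t s, i \in dom (prio E t)
               & #|[set j | prio E t j i]| < cap E t]].

Definition eliminate (I S : finType) (E : market I S) : market I S :=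
  Market (fun i => restrict (pref E i) [set s | ~~ irrelevant E i s])
         (fun s => restrict (prio E s) [set i | ~~ irrelevant E i s])
         (cap E).

Definition simplified (I S : finType) (E E' : market I S) : Prop :=
  exists k, E' = iter k (@eliminate I S) E /\ forall i s, ~~ irrelevant E' i s.

(* The truncated subtraction is exact whenever no school occurs in [sc] more  *)
(* often than its capacity, as [SMBP] requires.                               *)
Definition remaining (I S : finType) (E : market I S)
    (sc : 'I_#|I| -> option S) (k : 'I_#|I|) (s : option S) : nat :=
  cap E s - #|[set l : 'I_#|I| | (l < k) && (sc l == s)]|.

Definition SMBP (I S : finType) (E : market I S) : Prop :=
  exists (st : 'I_#|I| -> I) (sc : 'I_#|I| -> option S),
    [/\ bijective st,
        forall s, #|[set l | sc l == s]| <= cap E s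
      & forall k,
          is_best (pref E (st k)) [set s | 0 < remaining E sc k s] (sc k) /\
          st k \in top (remaining E sc k (sc k)) (prio E (sc k))
                       [set st l | l : 'I_#|I| & k <= l]].

Definition GMBP (I S : finType) (E : market I S) : Prop :=
  exists E', simplified E E' /\ SMBP E'.

(* In the three mechanisms the state is a set of pairs (student, school), or  *)
(* two disjoint ones, that only grows; a round that leaves it unchanged       *)
(* leaves it unchanged forever, so it is stationary after at most [rounds]    *)
(* rounds. For lists that are complete as in [school_choice_market], the      *)
(* outcome of the stationary state is that of the state at which the          *)
(* mechanism stops (no rejection, resp. every student accepted).              *)
Definition rounds (I S : finType) : nat := #|{: I * option S}|.

(* The default [None] is never used: [None] has a seat for every student.     *)
Definition allocation_of (I S : finType) (M : {set I * option S}) : allocation I S :=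
  [ffun i => odflt None [pick s | (i, s) \in M]].

(* In both deferred acceptance mechanisms the state [X] is the set of pairs   *)
(* between which a proposal has been made so far; [_held E X] are the pairs   *)
(* provisionally accepted, so that [X :\: _held E X] are those rejected.      *)
Definition student_DA_held (I S : finType) (E : market I S)
    (X : {set I * option S}) : {set I * option S} :=
  [set p in X |
    p.1 \in top (cap E p.2) (prio E p.2) [set i | (i, p.2) \in X]].

Definition student_DA_step (I S : finType) (E : market I S)
    (X : {set I * option S}) : {set I * option S} :=
  let H := student_DA_held E X in
  X :|: [set p | [forall s, (p.1, s) \notin H] &&
                 is_best (pref E p.1) [set s | (p.1, s) \notin X :\: H] p.2].

Definition student_DA (I S : finType) (E : market I S) : allocation I S :=
  allocation_of
    (student_DA_held E (iter (rounds I S) (student_DA_step E) set0)).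

Definition school_DA_held (I S : finType) (E : market I S)
    (X : {set I * option S}) : {set I * option S} :=
  [set p in X | is_best (pref E p.1) [set s | (p.1, s) \in X] p.2].

Definition school_DA_step (I S : finType) (E : market I S)
    (X : {set I * option S}) : {set I * option S} :=
  let H := school_DA_held E X in
  X :|: [set p | p.1 \in top (cap E p.2) (prio E p.2)
                             [set i | (i, p.2) \notin X :\: H]].

Definition school_DA (I S : finType) (E : market I S) : allocation I S :=
  allocation_of
    (school_DA_held E (iter (rounds I S) (school_DA_step E) set0)).

Definition seats (I S : finType) (E : market I S) (A : {set I * option S})
    (s : option S) : nat :=
  cap E s - #|[set i | (i, s) \in A]|.

(* State of immediate acceptance: accepted pairs and rejected pairs.          *)
Definition IA_step (I S : finType) (E : market I S)
    (AR : {set I * option S} * {set I * option S}) :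
    {set I * option S} * {set I * option S} :=
  let: (A, R) := AR in
  let P := [set p | [forall s, (p.1, s) \notin A] &&
                    is_best (pref E p.1)
                      [set s | (0 < seats E A s) && ((p.1, s) \notin R)] p.2] in
  let N := [set p in P | p.1 \in top (seats E A p.2) (prio E p.2)
                                     [set i | (i, p.2) \in P]] in
  (A :|: N, R :|: (P :\: N)).

Definition IA (I S : finType) (E : market I S) : allocation I S :=
  allocation_of (iter (rounds I S) (IA_step E) (set0, set0)).1.

Definition priority_extension (I S : finType) (E : market I S)
    (ext : S -> order_on I) : Prop :=
  forall s, dom (ext s) = setT /\
            forall i j, prio E (Some s) i j -> ext s i j.

Definition reported (I S : finType) (E : market I S) (ext : S -> order_on I)
    (Q : I -> order_on (option S)) : market I S :=
  Market Q
    (fun t => if t is Some s then restrict (ext s) [set i | Q i (Some s) None]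
              else prio E None)
    (cap E).

Definition deviate (I S : finType) (Q : I -> order_on (option S)) (i : I)
    (R : order_on (option S)) : I -> order_on (option S) :=
  fun j => if j == i then R else Q j.

Definition nash (I S : finType) (E : market I S) (ext : S -> order_on I)
    (phi : market I S -> allocation I S) (Q : I -> order_on (option S)) : Prop :=
  (forall i, dom (Q i) = setT) /\
  forall (i : I) (R : order_on (option S)), dom R = setT ->
    ~~ pref E i (phi (reported E ext (deviate Q i R)) i)
                (phi (reported E ext Q) i).

Definition nash_outcome (I S : finType) (E : market I S) (ext : S -> order_on I)
    (phi : market I S -> allocation I S) (mu : allocation I S) : Prop :=
  exists Q, nash E ext phi Q /\ phi (reported E ext Q) = mu.

(* Main.v *)
Require Import Defs.
From mathcomp Require Import all_boot.
Set Implicit Arguments.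
Unset Strict Implicit.
Unset Printing Implicit Defensive.

(* An envyfree allocation never uses an eliminated pair, so going through the *)
(* students in the SMBP order of the simplified market forces it; the same    *)
(* goes for any feasible allocation that weakly dominates the result. The     *)
(* order yields an envyfree allocation because the lists of the simplified    *)
(* market are upper segments of the original ones. Student-proposing DA is    *)
(* envyfree on every market, and the Nash outcomes of school-proposing DA and *)
(* of IA are the envyfree allocations: a student of a blocking pair gets the  *)
(* school by ranking it first, and an envyfree allocation is supported by     *)
(* everyone ranking her own school first and the outside option second.       *)

(** * Linear orders and top segments *)

(** The core is one induction along the SMBP order, in [GMBP_unique_efficient]. Let [nu] be feasible
    and agree with [sc] before turn [k]. Then [nu (st k)] still has a seat at turn [k], so if it is
    on the simplified list of [st k], she likes [sc k] at least as much. For an envyfree [nu] it is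
    on that list by [envyfree_reduced], and a strict preference for [sc k] would mean that the seats
    left there all go to students with priority over her, although she is among the top remaining
    ones. For a [nu] that weakly dominates the SMBP allocation it is on the list by upward closure
    ([reduced]), and the two comparisons force equality.

    The mechanisms enter through envyfreeness alone: [student_DA_envyfree] is the classical
    stability argument, and [nash_outcome_envyfree] treats both games at once. There, a student who
    gained [s] by deviating from an envyfree profile would join a full school whose students all
    keep their seats. What depends on the mechanism is that reporting [favorite s] wins [s] for a
    student who could block with it: [school_DA_obtain] and [IA_obtain]. *)

Lemma ord_dom (T : finType) (o : order_on T) x y :
  o x y -> (x \in dom o) /\ (y \in dom o).
Proof. by case: (order_onP o) => + _ _ _ oxy => /(_ _ _ oxy)/andP. Qed.

Lemma ord_irr (T : finType) (o : order_on T) x : o x x = false.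
Proof. by case: (order_onP o) => _ irr _ _; apply: irr. Qed.

Lemma ord_trans (T : finType) (o : order_on T) : transitive o.
Proof. by case: (order_onP o). Qed.

Lemma ord_total (T : finType) (o : order_on T) x y :
  x \in dom o -> y \in dom o -> x != y -> o x y || o y x.
Proof. by move=> xD yD; case: (order_onP o) => _ _ _; apply. Qed.

Lemma ord_asym (T : finType) (o : order_on T) x y : o x y -> o y x = false.
Proof.
by move=> oxy; apply/negP => /(ord_trans oxy); rewrite ord_irr.
Qed.

Lemma ord_neq (T : finType) (o : order_on T) x y : o x y -> x != y.
Proof. by move=> oxy; apply/eqP => exy; rewrite exy ord_irr in oxy. Qed.

(** The number of elements above serves as a rank, so that [arg_minnP] and [arg_maxnP] yield best
    and worst elements. *)
Lemma card_above_lt (T : finType) (o : order_on T) (B : {set T}) x y :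
  x \in B -> o x y ->
  #|[set z in B | o z x]| < #|[set z in B | o z y]|.
Proof.
move=> xB oxy; apply: proper_card; apply/properP; split.
  by apply/subsetP => z; rewrite !inE => /andP[-> /ord_trans]; apply.
by exists x; rewrite !inE xB ?oxy ?ord_irr.
Qed.

Lemma exists_best (T : finType) (o : order_on T) (A : {set T}) x :
  x \in A -> x \in dom o -> exists y, is_best o A y.
Proof.
move=> xA xD; have xB : x \in A :&: dom o by rewrite inE xA.
have [y /= yB ymin] := arg_minnP (fun y => #|[set z in A :&: dom o | o z y]|) xB.
have {}yB : y \in A :&: dom o by [].
exists y; rewrite /is_best yB; apply/forall_inP => z zB; rewrite /weakly.
case: eqVneq => //= yz; case/setIP: (yB) => _ yD; case/setIP: (zB) => _ zD.
have /orP[//|ozy] := ord_total yD zD yz.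
by have := ymin _ zB; rewrite leqNgt (card_above_lt zB ozy).
Qed.

Lemma is_bestP (T : finType) (o : order_on T) (A : {set T}) x :
  reflect [/\ x \in A, x \in dom o
            & forall y, y \in A -> y \in dom o -> y != x -> o x y]
          (is_best o A x).
Proof.
apply: (iffP andP) => [[/setIP[xA xD] /forall_inP xB]|[xA xD xB]].
  split=> // y yA yD yx; have := xB y; rewrite inE yA yD => /(_ isT).
  by rewrite /weakly eq_sym (negPf yx).
rewrite inE xA xD; split=> //; apply/forall_inP => y /setIP[yA yD].
by rewrite /weakly eq_sym; case: eqVneq => //= yx; apply: xB.
Qed.

Lemma is_best_uniq (T : finType) (o : order_on T) (A : {set T}) x y :
  is_best o A x -> is_best o A y -> x = y.
Proof.
case/is_bestP=> xA xD xB /is_bestP[yA yD yB].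
case: (eqVneq x y) => // xy; have oyx := yB x xA xD xy.
by have := ord_asym oyx; rewrite xB // eq_sym.
Qed.

Lemma card_top_le (T : finType) q (o : order_on T) (A : {set T}) :
  #|top q o A| <= q.
Proof.
have [->|[x0 x0T]] := set_0Vmem (top q o A); first by rewrite cards0.
have [x /= xT xmax] := arg_maxnP (fun y => #|[set z in A :&: dom o | o z y]|) x0T.
have {}xT : x \in top q o A by [].
move: (xT); rewrite inE => /andP[xB ltq].
apply: leq_trans ltq; rewrite (cardsD1 x) xT ltnS; apply/subset_leq_card/subsetP.
move=> y /setD1P[yx yT]; rewrite inE.
move: (yT); rewrite inE => /andP[yB _]; rewrite yB /=.
case/setIP: (xB) => _ xD; case/setIP: (yB) => _ yD.
have /orP[//|oxy] := ord_total yD xD yx.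
by have := xmax _ yT; rewrite /= leqNgt (card_above_lt xB oxy).
Qed.

(** Otherwise the best listed element outside [top] has only members of [top] above it, fewer than
    [q], and so belongs to [top]. *)
Lemma card_top_ge (T : finType) q (o : order_on T) (A : {set T}) :
  q <= #|A :&: dom o| -> q <= #|top q o A|.
Proof.
move=> leq; rewrite leqNgt; apply/negP => lt.
have [x0 x0B] : exists x, x \in (A :&: dom o) :\: top q o A.
  apply/set0Pn; rewrite -card_gt0 cardsD subn_gt0.
  apply: leq_ltn_trans (subset_leq_card (subsetIr _ _)) _.
  exact: leq_trans lt leq.
have [x /=] := arg_minnP (fun y => #|[set z in A :&: dom o | o z y]|) x0B.
rewrite -/(x \in _) => /setDP[xB /negP xT] xmin; apply: xT; rewrite inE xB /=.
apply: leq_ltn_trans lt; apply/subset_leq_card/subsetP => y.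
rewrite inE => /andP[yB oyx]; apply: contraT => yT.
have yBT : y \in (A :&: dom o) :\: top q o A by rewrite in_setD yT.
by have := xmin y yBT; rewrite leqNgt (card_above_lt yB oyx).
Qed.

(** Until it is stationary, every iteration gains an element, which can happen at most [#|T|]
    times. *)
Lemma iter_fixpoint (T : finType) (f : {set T} -> {set T}) :
  (forall X : {set T}, X \subset f X) ->
  f (iter #|T| f set0) = iter #|T| f set0.
Proof.
move=> f_ext; have: forall k, f (iter k f set0) = iter k f set0 \/
                            k < #|iter k.+1 f set0|.
  elim=> [|k [fk|lek]]; [|by left; rewrite iterS fk|].
    have [->|] := eqVneq (f set0) set0; [by left | right].
    by rewrite card_gt0.
  have [fk|neq] := eqVneq (f (iter k.+1 f set0)) (iter k.+1 f set0).
    by left.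
  right; apply: leq_ltn_trans lek _; apply: proper_card.
  by rewrite properEneq f_ext eq_sym neq.
by case/(_ #|T|) => // /leq_trans/(_ (max_card _)); rewrite ltnn.
Qed.

(** * Student-proposing deferred acceptance *)

Lemma allocation_of_unique (I S : finType) (M : {set I * option S}) i s :
  (i, s) \in M -> (forall t, (i, t) \in M -> t = s) -> allocation_of M i = s.
Proof.
move=> isM uniqM; rewrite ffunE; case: pickP => [t /uniqM //|none].
by rewrite none in isM.
Qed.

(** For real schools only: [None] could also be the default value. *)
Lemma allocation_of_Some (I S : finType) (M : {set I * option S}) i s :
  allocation_of M i = Some s -> (i, Some s) \in M.
Proof. by rewrite ffunE; case: pickP => //= t tM <-. Qed.

Lemma in_assigned (I S : finType) (mu : allocation I S) i s :
  (i \in assigned mu s) = (mu i == s).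
Proof. by rewrite inE. Qed.

Lemma pref_total (I S : finType) (E : market I S) i s t :
  school_choice_market E -> s != t -> pref E i s t || pref E i t s.
Proof. by case=> domE _ _ _ _ st; apply: ord_total; rewrite ?domE ?inE. Qed.

Lemma pref_dom (I S : finType) (E : market I S) i s :
  school_choice_market E -> s \in dom (pref E i).
Proof. by case=> domE _ _ _ _; rewrite domE inE. Qed.

Lemma prio_acceptable (I S : finType) (E : market I S) i s :
  school_choice_market E ->
  (i \in dom (prio E s)) = (s == None) || pref E i s None.
Proof. by case=> _ domP domN _ _; case: s => [s|]; rewrite ?domP ?domN inE. Qed.

Lemma cap_outside (I S : finType) (E : market I S) (A : {set I}) :
  school_choice_market E -> #|A| <= cap E None.
Proof. by case=> _ _ _ _ ->; apply: max_card. Qed.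

Lemma outside_has_seat (I S : finType) (E : market I S) (A : {set I}) i :
  school_choice_market E -> i \notin A -> #|A| < cap E None.
Proof.
case=> _ _ _ _ -> iA; rewrite -cardsT; apply: proper_card.
by apply/properP; split; [apply: subsetT | exists i].
Qed.

Lemma cap_gt0 (I S : finType) (E : market I S) (i : I) s :
  school_choice_market E -> 0 < cap E s.
Proof.
case: s => [s|] hE; first by case: hE.
by have := @outside_has_seat _ _ E set0 i hE; rewrite inE cards0; apply.
Qed.

Lemma envyfree_acceptable (I S : finType) (E : market I S) nu j :
  school_choice_market E -> envyfree E nu -> j \in dom (prio E (nu j)).
Proof.
move=> hE [_ nblk]; rewrite prio_acceptable //; case: eqVneq => //= nuN.
have /orP[//|pN] := pref_total j hE nuN.
have := nblk j None; rewrite /blocks pN /=.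
by rewrite (@outside_has_seat _ _ _ _ j) // inE.
Qed.

Lemma student_DA_envyfree (I S : finType) (E : market I S) :
  school_choice_market E -> envyfree E (student_DA E).
Proof.
move=> hE; set f := student_DA_step E; set X := iter (rounds I S) f set0.
have fX : f X = X by apply: iter_fixpoint => Y; apply: subsetUl.
pose H := student_DA_held E.
have rejS (Y Z : {set I * option S}) p :
    Y \subset Z -> p \in Y :\: H Y -> p \in Z :\: H Z.
  case: p => i s /subsetP YZ /setDP[pY pH]; rewrite inE (YZ _ pY) andbT.
  apply: contra pH; rewrite !inE pY (YZ _ pY) /= => /andP[-> lt] /=.
  apply: leq_ltn_trans lt; apply/subset_leq_card/subsetP => j.
  by rewrite !inE => /andP[/andP[/YZ-> ->] ->].
have noRejN (Y : {set I * option S}) i : (i, None) \notin Y :\: H Y.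
  case: (boolP ((i, None) \in Y)) => iY; last by rewrite inE (negPf iY) andbF.
  rewrite !inE iY prio_acceptable //= andbT negbK.
  by apply: (@outside_has_seat _ _ _ _ i); rewrite ?inE ?ord_irr ?andbF.
(* Proposals go down the list, and by [rejS] a rejection is never withdrawn. *)
have inv k i s t : (i, s) \in iter k f set0 -> pref E i t s ->
    (i, t) \in iter k f set0 :\: H (iter k f set0).
  elim: k => [|k IH]; first by rewrite inE.
  rewrite iterS; set Y := iter k f set0 in IH *.
  have YfY : Y \subset f Y by apply: subsetUl.
  rewrite {1}/f in_setU => /orP[isY its|].
    exact: rejS YfY (IH isY its).
  rewrite inE /= => /andP[_ /is_bestP[sA sD sB]] ts; apply: rejS YfY _.
  apply: contraT => tn; rewrite -(ord_asym ts).
  by apply: sB (ord_dom ts).1 (ord_neq ts); rewrite inE tn.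
have heldX i s t : (i, s) \in H X -> (i, t) \in H X -> t = s.
  move=> isH itH; apply/eqP; apply: contraT => ts.
  have isX : (i, s) \in X by case/setIdP: isH.
  have itX : (i, t) \in X by case/setIdP: itH.
  by have /orP[/(inv _ _ _ _ isX)|/(inv _ _ _ _ itX)] := pref_total i hE ts;
    rewrite in_setD -/X ?isH ?itH.
have held i : (i, student_DA E i) \in H X.
  have [|noH] := boolP [exists s, (i, s) \in H X].
    case/existsP=> s isH; rewrite /student_DA -/f -/X -/(H X).
    by rewrite (allocation_of_unique isH) // => t; apply: heldX isH.
  (* An unheld student would propose to her best school that has not rejected her; by stationarity
     she already has, so it holds her. *)
  have [s sb] : exists s, is_best (pref E i) [set s | (i, s) \notin X :\: H X] s.
    apply: (@exists_best _ _ _ None); last exact: pref_dom.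
    by rewrite inE noRejN.
  have isX : (i, s) \in X.
    rewrite -fX /f in_setU inE /= -/(H X) sb andbT; apply/orP; right.
    by rewrite -negb_exists.
  case/is_bestP: sb; rewrite inE in_setD isX andbT negbK => isH.
  by case/negP: noH; apply/existsP; exists s.
set mu := student_DA E in held *.
have muH i s : (i, s) \in H X -> mu i = s by move=> /(heldX _ _ _)/(_ (held i)).
have muE s : assigned mu s = top (cap E s) (prio E s) [set i | (i, s) \in X].
  apply/setP => i; rewrite inE; apply/eqP/idP => [<-|].
    by have := held i; rewrite /H /student_DA_held inE => /andP[_].
  move=> it; apply: muH; rewrite /H /student_DA_held inE it andbT.
  by move: it; rewrite !inE -andbA => /andP[].
have above_mu i s : pref E i s (mu i) ->
    [/\ (i, s) \in X, i \in dom (prio E s)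
      & cap E s <= #|[set y in [set j | (j, s) \in X] :&: dom (prio E s)
                           | prio E s y i]|].
  move=> smu; have imuX : (i, mu i) \in X by case/setIdP: (held i).
  have /setDP[isX isH] := inv _ _ _ _ imuX smu.
  have iD : i \in dom (prio E s).
    rewrite prio_acceptable //; case: eqVneq => //= sN.
    have /orP[//|Ns] := pref_total i hE sN.
    have := inv _ _ _ _ imuX (ord_trans Ns smu).
    by rewrite -/X (negPf (noRejN _ _)).
  split=> //; rewrite leqNgt; apply: contra isH => lt.
  by rewrite /H /student_DA_held !inE isX iD.
split=> [s|i s]; first by rewrite muE card_top_le.
apply/negP => /andP[/above_mu[isX iD ige] /orP[]].
- rewrite ltnNge muE card_top_ge //; apply: leq_trans ige _.
  by apply/subset_leq_card/subsetP => j; rewrite inE => /andP[].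
- case/existsP=> j /andP[]; rewrite muE inE => /andP[jB lt] ij.
  have := leq_trans lt ige; rewrite ltnNge => /negP; apply; apply: ltnW.
  by apply: card_above_lt => //; rewrite !inE isX.
Qed.

(** * Markets satisfying GMBP *)

(** Invariant of the elimination. The last clause, upward closure, transfers envyfreeness and
    efficiency of the SMBP allocation to the original market. *)
Definition reduced (I S : finType) (E F : market I S) : Prop :=
  [/\ cap F = cap E,
      forall i s t, pref F i s t =
        [&& s \in dom (pref F i), t \in dom (pref F i) & pref E i s t],
      forall s i j, prio F s i j =
        [&& i \in dom (prio F s), j \in dom (prio F s) & prio E s i j],
      forall i s, (i \in dom (prio F s)) =
        (i \in dom (prio E s)) && (s \in dom (pref F i))
    & forall i s t, s \in dom (pref F i) -> pref E i t s ->
        t \in dom (pref F i)].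

Lemma reduced_refl (I S : finType) (E : market I S) :
  school_choice_market E -> reduced E E.
Proof.
move=> hE; split=> // [i s t|s i j|i s|i s t _ _].
- by rewrite !pref_dom.
- by apply/idP/and3P=> [ij|[]//]; case: (ord_dom ij).
- by rewrite pref_dom ?andbT.
- exact: pref_dom.
Qed.

(** Upward closure survives because a school that makes [t] irrelevant also makes every [s] below
    [t] irrelevant. *)
Lemma reduced_eliminate (I S : finType) (E F : market I S) :
  reduced E F -> reduced E (eliminate F).
Proof.
case=> [hc hpref hprio hdom hup]; split=> // [i s t|s i j|i s|i s t].
- rewrite /= !inE hpref; case: (s \in dom _) => //=; last by rewrite !andbF.
  by case: (t \in dom _) => //=; rewrite !andbF.
- rewrite /= !inE hprio; case: (i \in dom _) => //=; last by rewrite !andbF.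
  by case: (j \in dom _) => //=; rewrite !andbF.
- by rewrite /= !inE hdom andbA.
rewrite /= !inE => /andP[sF srel] ts; have tF := hup _ _ _ sF ts.
rewrite tF; apply: contra srel => /existsP[u /and4P[ut Fut uD uq]].
have us : pref F i u s.
  move: Fut; rewrite !hpref => /and3P[uF _ ut']; rewrite uF sF.
  exact: ord_trans ut' ts.
by apply/existsP; exists u; rewrite us uD uq (ord_neq us).
Qed.

Lemma reduced_iter (I S : finType) (E : market I S) k :
  school_choice_market E -> reduced E (iter k (@eliminate I S) E).
Proof.
move=> hE; elim: k => [|k]; [exact: reduced_refl | exact: reduced_eliminate].
Qed.

Lemma envyfree_unblocked (I S : finType) (E : market I S) nu i s :
  envyfree E nu -> pref E i s (nu i) ->
  cap E s <= #|assigned nu s| /\ forall j, nu j = s -> ~~ prio E s i j.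
Proof.
case=> _ /(_ i s); rewrite /blocks => /[swap] -> /norP[].
rewrite -leqNgt negb_exists => -> /forallP nb; split=> // j js.
by have := nb j; rewrite !inE js eqxx.
Qed.

(* If [t] makes [nu i] irrelevant, then [i] is among the [cap t] students of  *)
(* highest priority at [t], so [i] has justified envy at [t].                 *)
Lemma envyfree_not_eliminated (I S : finType) (E F : market I S) nu :
  school_choice_market E -> reduced E F -> envyfree E nu ->
  (forall i, nu i \in dom (pref F i)) ->
  forall i, nu i \in dom (pref (eliminate F) i).
Proof.
move=> hE [hc hpref hprio hdom _] hnu nuF i; rewrite /= in_setI nuF inE.
apply/existsP => -[t /and4P[tn]]; rewrite hpref => /and3P[tF _ tnu] iD.
rewrite ltnNge => /negP; apply; rewrite hc.
have [full noenvy] := envyfree_unblocked hnu tnu.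
apply: leq_trans full _; apply/subset_leq_card/subsetP => j.
rewrite !inE => /eqP jt; have jD : j \in dom (prio F t).
  by rewrite hdom -{2}jt nuF andbT -jt envyfree_acceptable.
have ij : i != j by apply: contra tn => /eqP->; rewrite jt.
have /orP[|//] := ord_total iD jD ij.
by rewrite hprio (negPf (noenvy j jt)) !andbF.
Qed.

Lemma envyfree_reduced (I S : finType) (E : market I S) nu k i :
  school_choice_market E -> envyfree E nu ->
  nu i \in dom (pref (iter k (@eliminate I S) E) i).
Proof.
move=> hE hnu; elim: k i => [|k IH] i; first exact: pref_dom.
exact: envyfree_not_eliminated (reduced_iter k hE) hnu IH i.
Qed.

(** Under [nu], [st k] herself takes a seat beyond those of the earlier students placed there. *)
Lemma feasible_remaining (I S : finType) (E F : market I S) (nu : allocation I S)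
    (st : 'I_#|I| -> I) (sc : 'I_#|I| -> option S) (k : 'I_#|I|) :
  cap F = cap E -> feasible E nu -> injective st ->
  (forall l : 'I_#|I|, l < k -> nu (st l) = sc l) ->
  0 < remaining F sc k (nu (st k)).
Proof.
move=> hc hnu inj eqs; rewrite /remaining subn_gt0 hc.
apply: leq_trans (hnu (nu (st k))); rewrite (cardsD1 (st k)) inE eqxx ltnS.
rewrite -(card_imset _ inj); apply/subset_leq_card/subsetP => _ /imsetP[l + ->].
rewrite inE => /andP[lk /eqP scl]; rewrite !inE eqs // scl eqxx andbT.
by apply: contraTneq lk => /inj ->; rewrite ltnn.
Qed.

Lemma GMBP_unique_efficient (I S : finType) (E : market I S) :
  school_choice_market E -> GMBP E ->
  exists2 mu, unique (envyfree E) mu & efficient E mu.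
Proof.
move=> hE [F [[n [defF _]] [st [sc [st_bij sc_cap smbp]]]]].
have hred : reduced E F by rewrite defF; apply: reduced_iter.
case: (hred) => hc hpref hprio hdom hup.
case: (st_bij) => g gst stg; have st_inj := can_inj gst.
pose mu : allocation I S := [ffun i => sc (g i)].
have muE k : mu (st k) = sc k by rewrite ffunE gst.
have mu_feas : feasible E mu.
  move=> s; rewrite -hc; apply: leq_trans (sc_cap s).
  rewrite -(card_imset _ st_inj); apply/subset_leq_card/subsetP => i.
  rewrite inE ffunE => /eqP scs; apply/imsetP; exists (g i) => //.
  by rewrite inE scs.
have best nu k : feasible E nu -> nu (st k) \in dom (pref F (st k)) ->
    (forall l : 'I_#|I|, l < k -> nu (st l) = sc l) ->
    nu (st k) != sc k -> pref E (st k) (sc k) (nu (st k)).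
  move=> nu_feas nuF eqs neq; have [/is_bestP[_ _ scb] _] := smbp k.
  have := scb (nu (st k)); rewrite inE hpref.
  rewrite (feasible_remaining hc nu_feas st_inj eqs).
  by move=> /(_ isT nuF neq)/and3P[].
have ord_ind (P : 'I_#|I| -> Prop) :
    (forall k : 'I_#|I|, (forall l : 'I_#|I|, l < k -> P l) -> P k) ->
    forall k, P k.
  move=> step k; have [m] := ubnP (nat_of_ord k).
  elim: m k => // m IH k; rewrite ltnS => km; apply: step => l lk.
  by apply: IH; apply: leq_trans lk km.
exists mu; last first.
  split=> // -[nu [nu_feas nu_weak [i0 nu_lt]]].
  suff nuE k : nu (st k) = mu (st k).
    by move: nu_lt; rewrite -(stg i0) nuE ord_irr.
  elim/ord_ind: k => k IH; apply/eqP; apply: contraT => neq.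
  have nupref : pref E (st k) (nu (st k)) (mu (st k)).
    by have := nu_weak (st k); rewrite /weakly (negPf neq).
  have [/is_bestP[_ scF _] _] := smbp k.
  have nuF : nu (st k) \in dom (pref F (st k)).
    by apply: hup nupref; rewrite muE.
  rewrite -(ord_asym nupref) muE; apply: best => //; last by rewrite -muE.
  by move=> l lk; rewrite IH.
split.
  split=> // i s; apply/negP => /andP[smu].
  set k := g i; have ik : st k = i by apply: stg.
  have [/is_bestP[sc_rem scF scb] _] := smbp k.
  rewrite -ik muE in smu; have sF := hup _ _ _ scF smu.
  (* [sc k] is the best school with seats left, so the better [s] was exhausted before turn [k]. *)
  have full : cap E s <= #|[set l : 'I_#|I| | (l < k) && (sc l == s)]|.
    rewrite leqNgt -subn_gt0 -hc; apply/negP => srem.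
    have := scb s; rewrite inE srem hpref => /(_ isT sF (ord_neq smu)).
    by rewrite (ord_asym smu) !andbF.
  have sc_lt (l : 'I_#|I|) : sc l = s -> l < k.
    move=> scl; have : l \in [set l : 'I_#|I| | (l < k) && (sc l == s)].
      suff -> : [set l : 'I_#|I| | (l < k) && (sc l == s)] = [set l | sc l == s].
        by rewrite inE scl.
      apply/eqP; rewrite eqEcard; apply/andP; split.
        by apply/subsetP => x; rewrite !inE => /andP[].
      by apply: leq_trans (sc_cap s) _; rewrite hc.
    by rewrite inE => /andP[].
  rewrite ltnNge => /orP[/negP|].
    apply; apply: leq_trans full _; rewrite -(card_imset _ st_inj).
    apply/subset_leq_card/subsetP => _ /imsetP[l + ->].
    by rewrite !inE muE => /andP[].
  (* Among the students at [s] over whom [i] has priority, take the one who   *)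
  (* comes last in the ordering.                                              *)
  case/exists_inP=> j0; rewrite inE -(stg j0) muE => j0s ij0.
  pose C := [pred l : 'I_#|I| | (sc l == s) && prio E s i (st l)].
  have Cj0 : C (g j0) by rewrite /= j0s.
  have [l /= /andP[/eqP ls il] lmax] := arg_maxnP (@nat_of_ord _) Cj0.
  have [_] := smbp l; rewrite ls inE => /andP[/setIP[_ lD]].
  rewrite ltnNge => /negP; apply; rewrite /remaining hc leq_subLR.
  have iD : i \in dom (prio F s).
    by rewrite hdom (ord_dom il).1 -ik.
  (* [Z] has at least as many turns as [s] has seats left at turn [l]. Exchanging [l] for the turn
     of [i], who comes later and is not placed at [s], gives equally many students above [st l]: by
     the choice of [l], the others in [Z] are above [i]. *)
  pose Z := [set m : 'I_#|I| | (l <= m) && (sc m == s)].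
  apply: (@leq_trans (#|[set m : 'I_#|I| | (m < l) && (sc m == s)]| + #|Z|)).
    apply: leq_trans full (leq_trans _ (leq_card_setU _ _)).
    apply/subset_leq_card/subsetP => m; rewrite !inE => /andP[_ ->].
    by rewrite !andbT ltnNge orNb.
  rewrite leq_add2l (cardsD1 l) inE leqnn ls eqxx /= -(card_imset _ st_inj).
  rewrite -[1 + _]/((true : nat) + _).
  set W := st @: _; have iW : i \notin W.
    apply/imsetP => -[m]; rewrite !inE => /and3P[_ _ /eqP /sc_lt mk] im.
    by move: mk; rewrite /k im gst ltnn.
  rewrite -[true]iW -cardsU1; apply/subset_leq_card/subsetP => x.
  case/setU1P=> [->|/imsetP[m]].
    rewrite !inE iD hprio iD lD il !andbT; apply/imsetP; exists k => //.
    by rewrite inE ltnW // sc_lt.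
  rewrite !inE => /and3P[ml lm /eqP ms] ->.
  have mD : st m \in dom (prio F s).
    by have [_] := smbp m; rewrite ms inE => /andP[/setIP[]].
  rewrite mD andbT; apply/andP; split; first by apply/imsetP; exists m; rewrite ?inE.
  have mi : st m != i.
    by apply: contra iW => /eqP <-; rewrite imset_f ?inE ?ml ?lm ?ms /=.
  have /orP[mi'|] := ord_total mD iD mi.
    rewrite hprio mD lD; apply: ord_trans il; move: mi'; rewrite hprio.
    by case/and3P.
  rewrite hprio => /and3P[_ _ im]; have := lmax m; rewrite ms eqxx im => /(_ isT).
  by move=> mll; case/eqP: ml; apply/val_inj/eqP; rewrite /= eqn_leq mll lm.
move=> nu hnu; apply/ffunP => i; rewrite -(stg i); move: (g i) => k {i}.
suff -> : nu (st k) = sc k by rewrite muE.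
elim/ord_ind: k => k IH; apply/eqP; apply: contraT => neq.
have nuF i : nu i \in dom (pref F i).
  by rewrite defF; apply: envyfree_reduced.
have scnu := best nu k hnu.1 (nuF _) IH neq.
have [full noenvy] := envyfree_unblocked hnu scnu.
have [_] := smbp k; rewrite inE => /andP[/setIP[_ kD]].
rewrite ltnNge => /negP; case; rewrite /remaining hc.
apply: leq_trans (leq_sub2r _ full) _; rewrite -(card_imset _ st_inj).
(* The students of [sc k] under [nu] outside [W] come after turn [k] and have priority over [st k];
   they are at least as many as the seats left. *)
set W := st @: _; apply: leq_trans (_ : #|assigned nu (sc k) :\: W| <= _).
  rewrite cardsD leq_sub2l //; exact: subset_leq_card (subsetIr _ _).
apply/subset_leq_card/subsetP => j /setDP[+ jW].
rewrite in_assigned => /eqP js.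
have jD : j \in dom (prio F (sc k)).
  by rewrite hdom -js nuF envyfree_acceptable.
have kl : k <= g j.
  rewrite leqNgt; apply: contra jW => jk; apply/imsetP; exists (g j) => //.
  by rewrite inE jk -(IH _ jk) stg js eqxx.
rewrite !inE jD andbT; apply/andP; split.
  by apply/imsetP; exists (g j) => //; rewrite inE.
have kj : st k != j by apply: contra neq => /eqP->; rewrite js.
have /orP[|//] := ord_total kD jD kj.
by rewrite hprio (negPf (noenvy j js)) !andbF.
Qed.

(** * Nash equilibria of preference revelation games *)

Lemma is_best_sub (T : finType) (o : order_on T) (A B : {set T}) x :
  A \subset B -> x \in A -> is_best o B x -> is_best o A x.
Proof.
move=> /subsetP AB xA /is_bestP[_ xD xb]; apply/is_bestP; split=> // y yA.
exact/xb/AB.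
Qed.

Lemma is_best_first (T : finType) (o : order_on T) (A : {set T}) x :
  dom o = setT -> (forall y, y != x -> o x y) -> x \in A -> is_best o A x.
Proof.
by move=> domo xfirst xA; apply/is_bestP; rewrite domo inE; split=> // y _ _ /xfirst.
Qed.

Definition favorite_key (S : finType) (s t : option S) : nat :=
  if t == s then 0 else if t == None then 1 else (enum_rank t).+2.

Lemma favorite_subproof (S : finType) (s : option S) :
  strict_linear_on setT [rel x y | favorite_key s x < favorite_key s y].
Proof.
split=> [x y _|x|y x z|x y _ _ xy] /=; rewrite ?inE ?ltnn //; first exact: ltn_trans.
rewrite -neq_ltn; apply: contra xy => /eqP; rewrite /favorite_key.
case: (x =P s) => [->|_]; case: (y =P s) => [->|_] //; try by case: ifP.
case: (x =P None) => [->|_]; case: (y =P None) => [->|_] // [].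
by move/val_inj/enum_rank_inj => ->.
Qed.

(* [s] first, then the outside option, then the other schools. *)
Definition favorite (S : finType) (s : option S) : order_on (option S) :=
  OrderOn (favorite_subproof s).

Lemma favorite_first (S : finType) (s t : option S) :
  t != s -> favorite s s t.
Proof. by move=> ts; rewrite /= /favorite_key eqxx (negPf ts); case: ifP. Qed.

(** The reason for ranking the outside option second: the report puts the student on no other
    school's list. *)
Lemma favorite_acceptable (S : finType) (s t : option S) :
  t != None -> favorite s t None = (t == s).
Proof.
move=> tN; rewrite /= /favorite_key (negPf tN) eqxx.
case: (t =P s) => [<-|_]; first by rewrite eq_sym (negPf tN).
by case: ifP.
Qed.

(** Independent of the reports, so that runs under two profiles can be compared. *)
Definition base_prio (I S : finType) (E : market I S) (ext : S -> order_on I)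
    (t : option S) : order_on I :=
  if t is Some s then ext s else prio E None.

Definition listed (I S : finType) (Q : I -> order_on (option S)) (t : option S)
    (i : I) : bool :=
  (t == None) || Q i t None.

Lemma base_prio_ext (I S : finType) (E : market I S) ext t i j :
  priority_extension E ext -> prio E t i j -> base_prio E ext t i j.
Proof. by case: t => [s|] //= hx; apply: (hx s).2. Qed.

Lemma reported_dom (I S : finType) (E : market I S) ext Q t i :
  school_choice_market E -> priority_extension E ext ->
  (i \in dom (prio (reported E ext Q) t)) = listed Q t i.
Proof.
move=> hE hx; case: t => [s|] /=; first by rewrite !inE (hx s).1 inE.
by rewrite prio_acceptable.
Qed.

Lemma reported_prio (I S : finType) (E : market I S) ext Q t i j :
  prio (reported E ext Q) t i j =
  [&& listed Q t i, listed Q t j & base_prio E ext t i j].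
Proof. by case: t => [s|] //=; rewrite !inE. Qed.

Lemma above_reported (I S : finType) (E : market I S) ext Q t (B : {set I}) i j :
  school_choice_market E -> priority_extension E ext ->
  (j \in [set y in B :&: dom (prio (reported E ext Q) t)
            | prio (reported E ext Q) t y i]) =
  [&& j \in B, listed Q t j, listed Q t i & base_prio E ext t j i].
Proof.
move=> hE hx; rewrite inE in_setI reported_dom // reported_prio -andbA.
by case: (listed Q t j); rewrite ?andbF.
Qed.

Lemma deviate_dom (I S : finType) (Q : I -> order_on (option S)) i R :
  (forall j, dom (Q j) = setT) -> dom R = setT ->
  forall j, dom (deviate Q i R j) = setT.
Proof. by move=> domQ domR j; rewrite /deviate; case: ifP. Qed.

Lemma listed_deviate (I S : finType) (Q : I -> order_on (option S)) i R t j :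
  j != i -> listed (deviate Q i R) t j = listed Q t j.
Proof. by move=> ji; rewrite /listed /deviate (negPf ji). Qed.

Lemma listed_favorite (I S : finType) (Q : I -> order_on (option S)) i s t :
  listed (deviate Q i (favorite s)) t i = (t == None) || (t == s).
Proof.
rewrite /listed /deviate eqxx.
by case: (eqVneq t None) => //= tN; apply: favorite_acceptable.
Qed.

(* The only properties of a mechanism used for its Nash equilibria: besides   *)
(* feasibility, that a student whom her first choice never has a reason to    *)
(* reject gets it, and that reporting [favorite s] gets [s] for a student who *)
(* would otherwise block the outcome together with [s].                       *)
Lemma nash_outcome_envyfree (I S : finType) (E : market I S) ext
    (phi : market I S -> allocation I S) :
  school_choice_market E -> priority_extension E ext ->
  (forall Q, (forall i, dom (Q i) = setT) ->
     feasible E (phi (reported E ext Q))) ->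
  (forall Q i s, (forall i, dom (Q i) = setT) ->
     (forall t, t != s -> Q i s t) ->
     (forall B : {set I}, i \in B ->
        i \in top (cap E s) (prio (reported E ext Q) s) B) ->
     phi (reported E ext Q) i = s) ->
  (forall Q i s, (forall i, dom (Q i) = setT) ->
     #|assigned (phi (reported E ext Q)) s| < cap E s \/
       (exists2 j, phi (reported E ext Q) j = s & base_prio E ext s i j) ->
     phi (reported E ext (deviate Q i (favorite s))) i = s) ->
  forall nu, nash_outcome E ext phi nu <-> envyfree E nu.
Proof.
move=> hE hx feas first obtain nu; split=> [[Q [[domQ nashQ] <-]]|hnu].
  split=> [|i s]; first exact: feas.
  apply/negP => /andP[snu blk].
  have := nashQ i (favorite s) erefl; rewrite obtain ?snu //.
  case/orP: blk => [|/exists_inP[j]]; [by left | rewrite in_assigned => /eqP js ij].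
  by right; exists j => //; apply: base_prio_ext.
pose Q i := favorite (nu i).
have domQ i : dom (Q i) = setT by [].
have listedQ j s : listed Q s j = (s == None) || (s == nu j).
  by rewrite /listed; case: (eqVneq s None) => //= sN; apply: favorite_acceptable.
have above_nu Q' j (B : {set I}) :
    (forall y, prio (reported E ext Q') (nu j) y j ->
       listed Q (nu j) y) ->
    #|[set y in B :&: dom (prio (reported E ext Q') (nu j))
         | prio (reported E ext Q') (nu j) y j]| < cap E (nu j).
  move=> list_nu; case: (eqVneq (nu j) None) => [->|nuN].
    by apply: (@outside_has_seat _ _ _ _ j) => //; rewrite !inE ord_irr andbF.
  apply: leq_trans (hnu.1 (nu j)); apply: proper_card; apply/properP; split.
    apply/subsetP => y; rewrite inE => /andP[_ /list_nu].
    by rewrite listedQ (negPf nuN) in_assigned eq_sym.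
  by exists j; rewrite ?in_assigned // inE ord_irr andbF.
have QE : phi (reported E ext Q) = nu.
  apply/ffunP => i; apply: first => // [t|B iB]; first exact: favorite_first.
  rewrite inE in_setI iB reported_dom // listedQ eqxx orbT andTb.
  by apply: above_nu => y; rewrite reported_prio => /andP[].
exists Q; split=> //; split=> // i R domR; rewrite QE; set F := reported E ext _.
set s := phi F i; apply/negP => snu.
have [full noenvy] := envyfree_unblocked hnu snu.
have acc j : nu j = s -> j \in dom (prio E s).
  by move=> <-; apply: envyfree_acceptable.
have nuN : ~~ pref E i None (nu i).
  apply/negP => Nnu; have [] := envyfree_unblocked hnu Nnu.
  rewrite leqNgt (@outside_has_seat _ _ _ _ i) // in_assigned eq_sym.
  by rewrite (ord_neq Nnu).
(* [noenvy] concerns [prio E], the reported markets use [base_prio]; the two agree on students who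
   are both on the true list of [s]. *)
have iD : i \in dom (prio E s).
  rewrite prio_acceptable //; case: eqVneq => //= sN.
  have /orP[//|Ns] := pref_total i hE sN.
  by case/negP: nuN; apply: ord_trans Ns snu.
have nuF j : nu j = s -> phi F j = s.
  move=> js; have ji : j != i.
    by apply: contraTneq snu => <-; rewrite js ord_irr.
  apply: first => [|t ts|B jB]; first exact: deviate_dom.
    by rewrite /deviate (negPf ji) /Q js; apply: favorite_first.
  rewrite inE in_setI jB reported_dom // listed_deviate // listedQ js eqxx.
  rewrite orbT andTb.
  rewrite -js; apply: above_nu => y; rewrite reported_prio.
  case: (eqVneq y i) => [->|yi]; last by rewrite listed_deviate // => /andP[].
  rewrite js eq_sym in ji * => /and3P[_ _ ij].
  have /orP[ij'|/(base_prio_ext hx) ji'] := ord_total iD (acc j js) ji.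
    by have := noenvy j js; rewrite ij'.
  by rewrite (ord_asym ij) in ji'.
(* The deviator is one student too many at the full school [s]. *)
have: #|i |: assigned nu s| <= cap E s.
  have feasF : feasible E (phi F) by apply/feas/deviate_dom.
  apply: leq_trans (feasF s); apply/subset_leq_card/subsetP => j /setU1P[->|].
    by rewrite in_assigned.
  by rewrite !in_assigned => /eqP/nuF->.
rewrite cardsU1 in_assigned eq_sym (ord_neq snu) add1n.
by rewrite ltnNge full.
Qed.

(** * School-proposing deferred acceptance *)

Definition school_DA_state (I S : finType) (F : market I S) k :=
  iter k (school_DA_step F) set0.

(** The pool from which [s] chooses: those who have not rejected it, whether already proposed to or
    not. *)
Definition school_DA_open (I S : finType) (F : market I S)
    (X : {set I * option S}) (s : option S) : {set I} :=
  [set i | (i, s) \notin X :\: school_DA_held F X].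

Lemma school_DA_stepE (I S : finType) (F : market I S) X i s :
  ((i, s) \in school_DA_step F X) =
  ((i, s) \in X) || (i \in top (cap F s) (prio F s) (school_DA_open F X s)).
Proof. by rewrite in_setU [X in _ || X]inE. Qed.

Lemma school_DA_openE (I S : finType) (F : market I S) X i s :
  (i \in school_DA_open F X s) =
  ((i, s) \in X) ==> is_best (pref F i) [set t | (i, t) \in X] s.
Proof.
rewrite inE in_setD [_ \in school_DA_held _ _]inE.
by case: (_ \in X); rewrite ?andbT ?andbF ?negbK.
Qed.

(** A student's best offer stays best among fewer offers. Used with [F = G] this makes rejections
    permanent; with two markets it compares two runs. *)
Lemma school_DA_openS (I S : finType) (F G : market I S)
    (X Y : {set I * option S}) i s :
  pref F i = pref G i -> (forall t, (i, t) \in X -> (i, t) \in Y) ->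
  i \in school_DA_open G Y s -> i \in school_DA_open F X s.
Proof.
move=> FG XY; rewrite !school_DA_openE => /implyP iY; apply/implyP => isX.
rewrite FG; apply: is_best_sub (iY (XY _ isX)); last by rewrite inE.
by apply/subsetP => t; rewrite !inE; apply: XY.
Qed.

Lemma school_DA_fix (I S : finType) (F : market I S) :
  school_DA_step F (school_DA_state F (rounds I S)) =
  school_DA_state F (rounds I S).
Proof. by apply: iter_fixpoint => X; apply: subsetUl. Qed.

(** The pool only shrinks, so a student once in its top segment stays there until she rejects
    [s]. *)
Lemma school_DA_held_top (I S : finType) (F : market I S) k i s :
  let X := school_DA_state F k in
  (i, s) \in X -> i \in school_DA_open F X s ->
  i \in top (cap F s) (prio F s) (school_DA_open F X s).
Proof.
elim: k => [|k IH]; first by rewrite /school_DA_state /= in_set0.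
move: IH; rewrite /school_DA_state iterS; set X := iter _ _ _.
move=> /= IH isX' io'; set X' := school_DA_step F X in isX' io' *.
have openS j : j \in school_DA_open F X' s -> j \in school_DA_open F X s.
  by apply: school_DA_openS => // t; rewrite school_DA_stepE => ->.
have : i \in top (cap F s) (prio F s) (school_DA_open F X s).
  by move: isX'; rewrite school_DA_stepE => /orP[/IH->|//]; last exact: openS.
rewrite inE in_setI => /andP[/andP[_ iD] lt]; rewrite inE in_setI io' iD.
apply: leq_ltn_trans lt; apply/subset_leq_card/subsetP => j.
case/setIdP=> /setIP[jo jD] ji; apply/setIdP; split=> //; apply/setIP.
by split=> //; apply: openS.
Qed.

Lemma school_DA_heldE (I S : finType) (F : market I S) i s :
  let X := school_DA_state F (rounds I S) in
  (i, s) \in X -> i \in school_DA_open F X s -> school_DA F i = s.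
Proof.
move=> X isX; rewrite school_DA_openE isX => sb.
apply: allocation_of_unique => [|t]; first by rewrite inE isX.
by rewrite inE => /andP[_ tb]; apply: is_best_uniq tb sb.
Qed.

Lemma school_DA_not_outside (I S : finType) (F : market I S) i s :
  let X := school_DA_state F (rounds I S) in
  s != None -> school_DA F i = s ->
  (i, s) \in X /\ i \in school_DA_open F X s.
Proof.
case: s => // s X _ /allocation_of_Some; rewrite inE => /andP[isX sb].
by rewrite school_DA_openE isX.
Qed.

Lemma school_DA_unproposed (I S : finType) (F : market I S) i s :
  let X := school_DA_state F (rounds I S) in
  i \in dom (prio F s) -> (i, s) \notin X ->
  i \in school_DA_open F X s /\
  cap F s <= #|[set y in school_DA_open F X s :&: dom (prio F s)
                   | prio F s y i]|.
Proof.
move=> X iD isX; have io : i \in school_DA_open F X s.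
  by rewrite school_DA_openE (negPf isX).
split=> //; rewrite leqNgt; apply: contra isX => lt.
by rewrite /X -school_DA_fix school_DA_stepE inE in_setI io iD lt orbT.
Qed.

Lemma school_DA_feasible (I S : finType) (E F : market I S) :
  school_choice_market E -> cap F = cap E -> feasible E (school_DA F).
Proof.
move=> hE hc [s|]; last exact: cap_outside.
rewrite -hc; apply: leq_trans (card_top_le _ (prio F (Some s))
  (school_DA_open F (school_DA_state F (rounds I S)) (Some s))).
apply/subset_leq_card/subsetP => i; rewrite in_assigned => /eqP.
by case/(@school_DA_not_outside _ _ _ _ (Some s) isT); apply: school_DA_held_top.
Qed.

Lemma school_DA_first (I S : finType) (F : market I S) i s :
  dom (pref F i) = setT -> (forall t, t != s -> pref F i s t) ->
  (forall B : {set I}, i \in B -> i \in top (cap F s) (prio F s) B) ->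
  school_DA F i = s.
Proof.
move=> domi sfirst itop; set X := school_DA_state F (rounds I S).
have io : i \in school_DA_open F X s.
  rewrite school_DA_openE; apply/implyP => isX.
  by apply: is_best_first; rewrite ?inE.
by apply: school_DA_heldE => //; rewrite -school_DA_fix school_DA_stepE itop ?orbT.
Qed.

(* Under the report [favorite s], [i] rejects every school other than [s] and *)
(* the outside option, so as long as [s] does not propose to [i] all the      *)
(* proposals to the other students in the original run are also made in the   *)
(* new one. In the new run [s] thus has at least as many rejections as in the *)
(* original one, and runs through its list until it reaches [i].              *)
Lemma school_DA_obtain (I S : finType) (E : market I S) ext Q i s :
  school_choice_market E -> priority_extension E ext ->
  let nu := school_DA (reported E ext Q) in
  #|assigned nu s| < cap E s \/
    (exists2 j, nu j = s & base_prio E ext s i j) ->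
  school_DA (reported E ext (deviate Q i (favorite s))) i = s.
Proof.
move=> hE hx nu; set F := reported E ext Q; set G := reported E ext _ => blk.
set XF := school_DA_state F (rounds I S).
set XG := school_DA_state G (rounds I S).
have outside j : (j, None) \in XG.
  apply: contraT => jG; have jD : j \in dom (prio G None) by rewrite reported_dom.
  have [_] := school_DA_unproposed jD jG; rewrite leqNgt.
  by rewrite (outside_has_seat (i := j) hE) // !inE ord_irr andbF.
have [|isG] := boolP ((i, s) \in XG).
  move=> isG; apply: (school_DA_heldE isG); rewrite school_DA_openE isG.
  apply: is_best_first; rewrite ?inE //= /deviate eqxx // => t.
  exact: favorite_first.
have sN : s != None by apply: contraNneq isG => ->.
have iD : i \in dom (prio G s) by rewrite reported_dom // listed_favorite eqxx orbT.
have [io full] := school_DA_unproposed iD isG; rewrite -/XG in io full.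
have openS k t j : (forall u, (j, u) \in school_DA_state F k -> (j, u) \in XG) ->
    j != i -> j \in school_DA_open G XG t ->
    j \in school_DA_open F (school_DA_state F k) t.
  by move=> sub ji; apply: school_DA_openS => //=; rewrite /deviate (negPf ji).
have sub k j t : j != i -> (j, t) \in school_DA_state F k -> (j, t) \in XG.
  elim: k j t => [|k IH] j t ji; first by rewrite /school_DA_state /= in_set0.
  rewrite /school_DA_state iterS -/(school_DA_state F k) school_DA_stepE.
  case/orP=> [|jtop]; first exact: IH.
  apply: contraT => jtG; have tN : t != None by apply: contraNneq jtG => ->.
  move: jtop; rewrite inE in_setI reported_dom // => /andP[/andP[_ jD] lt].
  have jG : j \in dom (prio G t) by rewrite reported_dom // listed_deviate.
  have [_ jfull] := school_DA_unproposed jG jtG.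
  have openS' y : y != i -> y \in school_DA_open G XG t ->
      y \in school_DA_open F (school_DA_state F k) t.
    by move=> yi; apply: openS => // u; apply: IH.
  (* Only [i] can be newly above [j] at [t]. If she is above [j], then [t = s] and too few students
     are above [i] for [full]; if not, those above [j] already were in the original run, too few for
     [jfull]. *)
  case: (boolP (listed (deviate Q i (favorite s)) t i && base_prio E ext t i j)).
    rewrite listed_favorite (negPf tN) => /andP[/eqP ts ij].
    suff: #|[set y in school_DA_open G XG s :&: dom (prio G s)
               | prio G s y i]| < cap F s.
      by rewrite ltnNge full.
    subst t; apply: leq_ltn_trans lt; apply/subset_leq_card/subsetP => y.
    rewrite !above_reported // => /and4P[yo yl _ yi].
    have yni := ord_neq yi; rewrite listed_deviate // in yl.
    by rewrite openS' // yl jD (ord_trans yi ij).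
  move=> nij; suff: cap G t < cap F t by rewrite ltnn.
  apply: leq_ltn_trans jfull (leq_ltn_trans _ lt).
  apply/subset_leq_card/subsetP => y.
  rewrite !above_reported // => /and4P[yo yl _ yj].
  have yni : y != i by apply: contraNneq nij => yi; rewrite yi in yl yj; rewrite yl.
  by rewrite listed_deviate // in yl; rewrite openS' // yl jD.
have above_i y :
    y \in [set y in school_DA_open G XG s :&: dom (prio G s) | prio G s y i] ->
    [/\ y \in school_DA_open F XF s, listed Q s y & base_prio E ext s y i].
  rewrite above_reported // => /and4P[yo yl _ yi].
  have yni := ord_neq yi; rewrite listed_deviate // in yl; split=> //.
  by apply: openS => // u; apply: sub.
case: blk => [|[j js ij]].
  rewrite ltnNge => /negP; case.
  apply: leq_trans (_ : #|top (cap F s) (prio F s) (school_DA_open F XF s)| <= _).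
    apply: card_top_ge; apply: leq_trans full _; apply/subset_leq_card/subsetP => y.
    by case/above_i=> yo yl _; rewrite in_setI yo reported_dom.
  apply/subset_leq_card/subsetP => y ytop; rewrite in_assigned; apply/eqP.
  apply: school_DA_heldE; first by rewrite -school_DA_fix school_DA_stepE ytop orbT.
  by move: ytop; rewrite inE in_setI => /andP[/andP[]].
have [jsX jo] := school_DA_not_outside sN js.
have := school_DA_held_top jsX jo; rewrite inE => /andP[/setIP[_ jD]].
rewrite ltnNge => /negP; case; apply: leq_trans full _.
apply/subset_leq_card/subsetP => y /above_i[yo yl yi].
rewrite above_reported // yo yl (ord_trans yi ij) andbT.
by rewrite reported_dom // in jD.
Qed.

(** * Immediate acceptance *)

Definition IA_state (I S : finType) (F : market I S) k :=
  iter k (IA_step F) (set0, set0).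

Definition IA_proposals (I S : finType) (F : market I S)
    (AR : {set I * option S} * {set I * option S}) : {set I * option S} :=
  [set p | [forall s, (p.1, s) \notin AR.1] &&
           is_best (pref F p.1)
             [set s | (0 < seats F AR.1 s) && ((p.1, s) \notin AR.2)] p.2].

Lemma IA_stepE (I S : finType) (F : market I S) AR i s :
  ((i, s) \in (IA_step F AR).1) =
  ((i, s) \in AR.1) || ((i, s) \in IA_proposals F AR) &&
    (i \in top (seats F AR.1 s) (prio F s) [set j | (j, s) \in IA_proposals F AR]).
Proof. by case: AR => A R; rewrite in_setU [X in _ || X]inE. Qed.

Lemma IA_accepted_uniq (I S : finType) (F : market I S) k i s t :
  (i, s) \in (IA_state F k).1 -> (i, t) \in (IA_state F k).1 -> s = t.
Proof.
elim: k => [|k IH]; first by rewrite /IA_state /= in_set0.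
rewrite /IA_state iterS -/(IA_state F k) !IA_stepE ![_ \in IA_proposals _ _]inE /=.
case/orP=> [isA|/andP[/andP[/forallP noA sb] _]].
  case/orP=> [|/andP[/andP[/forallP/(_ s)]]]; [exact: IH | by rewrite isA].
case/orP=> [itA|/andP[/andP[_ tb] _]]; first by have := noA t; rewrite itA.
exact: is_best_uniq sb tb.
Qed.

Lemma IA_stateS (I S : finType) (F : market I S) k m i s :
  k <= m -> (i, s) \in (IA_state F k).1 -> (i, s) \in (IA_state F m).1.
Proof.
move=> /subnK <-; elim: (m - k) => // n IH /IH.
by rewrite addSn /IA_state iterS IA_stepE => ->.
Qed.

Lemma IA_accepted (I S : finType) (F : market I S) k i s :
  k <= rounds I S -> (i, s) \in (IA_state F k).1 -> IA F i = s.
Proof.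
move=> kr /(IA_stateS kr) isA; apply: (allocation_of_unique isA) => t itA.
exact: IA_accepted_uniq itA isA.
Qed.

Lemma IA_accepted_le (I S : finType) (F : market I S) k s :
  #|[set i | (i, s) \in (IA_state F k).1]| <= cap F s.
Proof.
elim: k => [|k IH].
  rewrite (_ : [set i | _] = set0) ?cards0 //.
  by apply/setP => i; rewrite /IA_state /= !inE.
(* [IH] makes the truncated subtraction in [seats] exact. *)
rewrite -(subnKC IH); apply: leq_trans (leq_add (leqnn _) (card_top_le _ (prio F s)
  [set j | (j, s) \in IA_proposals F (IA_state F k)])).
apply: leq_trans (leq_card_setU _ _); apply/subset_leq_card/subsetP => i.
rewrite inE /IA_state iterS IA_stepE in_setU => /orP[isA|/andP[_ ->]].
  by rewrite inE isA.
by rewrite orbT.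
Qed.

Lemma IA_feasible (I S : finType) (E F : market I S) :
  school_choice_market E -> cap F = cap E -> feasible E (IA F).
Proof.
move=> hE hc [s|]; last exact: cap_outside.
rewrite -hc; apply: leq_trans (IA_accepted_le F (rounds I S) (Some s)).
apply/subset_leq_card/subsetP => i; rewrite in_assigned inE => /eqP.
exact: allocation_of_Some.
Qed.

Definition IA_first_proposers (I S : finType) (F : market I S)
    (s : option S) : {set I} :=
  [set i | is_best (pref F i) [set t | 0 < cap F t] s].

(** In the first round all seats are free, and acceptance is final. *)
Lemma IA_first_round (I S : finType) (F : market I S) i s :
  i \in top (cap F s) (prio F s) (IA_first_proposers F s) -> IA F i = s.
Proof.
move=> itop; apply: (@IA_accepted _ _ _ 1).
  by apply/card_gt0P; exists (i, s).
have seats0 t : seats F set0 t = cap F t.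
  rewrite /seats (_ : [set j | _] = set0) ?cards0 ?subn0 //.
  by apply/setP => j; rewrite !inE.
have prop0 j : ((j, s) \in IA_proposals F (set0, set0)) =
               (j \in IA_first_proposers F s).
  rewrite !inE /= (_ : [forall t, _]); last by apply/forallP => t; rewrite inE.
  rewrite (_ : [set t | _ && _] = [set t | 0 < cap F t]) //.
  by apply/setP => t; rewrite !inE seats0 andbT.
rewrite -[IA_state F 1]/(IA_step F (set0, set0)) IA_stepE /= in_set0 /= prop0 seats0.
rewrite (_ : [set j | _] = IA_first_proposers F s); last first.
  by apply/setP => j; rewrite inE prop0.
by rewrite itop andbT; move: itop; rewrite inE => /andP[/setIP[]].
Qed.

Lemma IA_first (I S : finType) (E F : market I S) i s :
  school_choice_market E -> cap F = cap E ->
  dom (pref F i) = setT -> (forall t, t != s -> pref F i s t) ->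
  (forall B : {set I}, i \in B -> i \in top (cap F s) (prio F s) B) ->
  IA F i = s.
Proof.
move=> hE hc domi sfirst itop; apply: IA_first_round; apply: itop.
rewrite inE; apply: is_best_first => //; rewrite inE hc.
exact: cap_gt0 i s hE.
Qed.

(* The other students propose in the first round as they did originally, so   *)
(* if [s] rejected [i] then it would have been filled, in the first round of  *)
(* the original run, with students having priority over [i].                  *)
Lemma IA_obtain (I S : finType) (E : market I S) ext Q i s :
  school_choice_market E -> priority_extension E ext ->
  let nu := IA (reported E ext Q) in
  #|assigned nu s| < cap E s \/
    (exists2 j, nu j = s & base_prio E ext s i j) ->
  IA (reported E ext (deviate Q i (favorite s))) i = s.
Proof.
move=> hE hx nu; set F := reported E ext Q; set G := reported E ext _ => blk.
have cap_s := cap_gt0 i s hE.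
apply: IA_first_round; apply: contraT => itop.
have full : cap E s <= #|[set y in IA_first_proposers G s :&: dom (prio G s)
                              | prio G s y i]|.
  rewrite leqNgt; apply: contra itop => lt; rewrite inE lt andbT in_setI.
  rewrite reported_dom // listed_favorite eqxx orbT andbT inE.
  apply: is_best_first; rewrite ?inE //= /deviate eqxx // => t.
  exact: favorite_first.
have above_i y :
    y \in [set y in IA_first_proposers G s :&: dom (prio G s) | prio G s y i] ->
    [/\ y \in IA_first_proposers F s, listed Q s y & base_prio E ext s y i].
  rewrite above_reported // => /and4P[yo yl _ yi].
  have yni := ord_neq yi; rewrite listed_deviate // in yl; split=> //.
  by move: yo; rewrite !inE /= /deviate (negPf yni).
have topS : top (cap F s) (prio F s) (IA_first_proposers F s) \subset assigned nu s.
  by apply/subsetP => y /IA_first_round ys; rewrite in_assigned; apply/eqP.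
have top_full : cap E s <= #|top (cap F s) (prio F s) (IA_first_proposers F s)|.
  apply: card_top_ge; apply: leq_trans full _; apply/subset_leq_card/subsetP => y.
  by case/above_i=> yo yl _; rewrite in_setI yo reported_dom.
case: blk => [|[j js ij]].
  rewrite ltnNge => /negP; case; apply: leq_trans top_full _.
  exact: subset_leq_card.
(* [s] fills up in the first round of the original run, so [nu] gives it exactly the students
   accepted then, among them [j]. *)
have /eqP topE : top (cap F s) (prio F s) (IA_first_proposers F s) == assigned nu s.
  by rewrite eqEcard topS; apply: leq_trans top_full; apply: IA_feasible.
have := in_assigned nu j s; rewrite js eqxx -topE inE => /andP[/setIP[_ jD]].
rewrite ltnNge => /negP; case; apply: leq_trans full _.
apply/subset_leq_card/subsetP => y /above_i[yo yl yi].
rewrite above_reported // yo yl (ord_trans yi ij) andbT.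
by rewrite reported_dom // in jD.
Qed.

Theorem proposition1 (I S : finType) (E : market I S)
    (hE : school_choice_market E) (hG : GMBP E) :
  exists mu : allocation I S,
    [/\ unique (envyfree E) mu,
        efficient E mu,
        student_DA E = mu
      & forall ext : S -> order_on I, priority_extension E ext ->
          (forall nu, nash_outcome E ext (@school_DA I S) nu <-> nu = mu) /\
          (forall nu, nash_outcome E ext (@IA I S) nu <-> nu = mu)].
Proof.
have [mu [mu_ef mu_uniq] mu_eff] := GMBP_unique_efficient hE hG.
have muE nu : envyfree E nu <-> nu = mu.
  by split=> [/mu_uniq|->].
exists mu; split=> //; first exact/muE/student_DA_envyfree.
move=> ext hx; split=> nu.
all: apply: iff_trans (nash_outcome_envyfree hE hx _ _ _ nu) (muE nu) => Q.
- by move=> _; apply: school_DA_feasible.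
- by move=> i s domQ sfirst itop; apply: school_DA_first.
- by move=> i s _; apply: school_DA_obtain.
- by move=> _; apply: IA_feasible.
- by move=> i s domQ sfirst itop; apply: (IA_first hE).
- by move=> i s _; apply: IA_obtain.
Qed.
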